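(* Let $e$ be a positive integer, let $p$ be a prime, let $H$ be a finite $e$-generated group, and let $V$ be a simple $\mathbb{Z}_pH$-module. Then there is a finite $e$-generated group $\hat H_{V,e}$ (called the $(V,e)$-cover of $H$) such that $\hat H_{V,e}$ is an extension of $H$ with a $V$-homogeneous module, and every $e$-generated group that is an extension of $H$ with a $V$-homogeneous module is a quotient of $\hat H_{V,e}$.
   Context: $\mathbb{Z}_p$ denotes the integers modulo $p$; all modules are finite-dimensional. A group is $e$-generated if it can be generated by $e$ elements. A $\mathbb{Z}_pH$-module $A$ is $V$-homogeneous if it is isomorphic to a direct sum of finitely many (possibly zero) copies of the simple module $V$. A group $E$ is an extension of $H$ with a $\mathbb{Z}_pH$-module $A$ if there is an epimorphism $E\to H$ whose kernel $K$ is abelian and, with $H$ acting on $K$ through conjugation by preimages in $E$, is isomorphic to $A$ as an $H$-module. *)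

(* Defs.v *)
From HB Require Import structures.
From mathcomp Require Import all_boot all_order all_algebra.
From mathcomp Require Import all_fingroup all_solvable all_field all_character.

Set Implicit Arguments.
Unset Strict Implicit.
Unset Printing Implicit Defensive.

Import GRing.Theory.
Local Open Scope group_scope.

(* Groups are not assumed to be finite here: [groupType] is used instead of
   [{group gT}], and subgroups are [Prop]-valued predicates. *)

Definition is_subgroup (G : groupType) (S : G -> Prop) : Prop :=
  [/\ S 1,
      forall x y, S x -> S y -> S (x * y)
    & forall x, S x -> S x^-1].

(* The generators [x i] need not be distinct, so this is generation by at most
   [e] elements. *)
Definition e_generated (e : nat) (G : groupType) : Prop :=
  exists x : 'I_e -> G,
    forall S : G -> Prop, is_subgroup S -> (forall i, S (x i)) ->
    forall g, S g.

Definition epimorphism (G Q : groupType) (f : {multiplicative G -> Q}) : Prop :=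
  forall q : Q, exists g : G, f g = q.

Definition is_quotient_of (Q G : groupType) : Prop :=
  exists f : {multiplicative G -> Q}, epimorphism f.

(* A finite-dimensional Z_p H-module is the row space 'rV['F_p]_m, on which
   h : H acts on the right by u |-> u *m rA h. For k = 0, [muln_grepr] is the
   zero module. *)
Definition homogeneous (p : nat) (H : finGroupType)
    (n : nat) (rV : mx_representation 'F_p [set: H] n)
    (m : nat) (rA : mx_representation 'F_p [set: H] m) : Prop :=
  exists k : nat, mx_rsim rA (muln_grepr (Representation rV) k).

(* [iota] is the module isomorphism from A onto the kernel of [f]; its last
   clause says that h : H acts on the kernel through conjugation,
   k |-> x^-1 * k * x, by any preimage x of h. *)
Definition is_extension (p : nat) (H : finGroupType)
    (m : nat) (rA : mx_representation 'F_p [set: H] m) (E : groupType) : Prop :=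
  exists2 f : {multiplicative E -> H}, epimorphism f &
    (forall x y : E, f x = 1 -> f y = 1 -> commute x y) /\
    exists iota : 'rV['F_p]_m -> E,
      [/\ injective iota,
          forall x : E, f x = 1 <-> exists u, iota u = x,
          forall u v, iota (u + v)%R = iota u * iota v
        & forall u (x : E), iota (u *m rA (f x))%R = iota u ^ x].

Definition is_homogeneous_extension (p : nat) (H : finGroupType)
    (n : nat) (rV : mx_representation 'F_p [set: H] n) (E : groupType) : Prop :=
  exists (m : nat) (rA : mx_representation 'F_p [set: H] m),
    homogeneous rV rA /\ is_extension rA E.

(* Main.v *)
(* Call an extension of [H] marked if its generators map to a fixed generating
   tuple [h] of [H]. By Schreier's argument the marked extensions with
   [V]-homogeneous kernel have bounded order; let [C] be one of maximal order.
   For another one [E], the subgroup of [C * E] generated by the pairs of marked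
   generators is again such an extension, so by maximality its projection onto
   [C] is an isomorphism, and [E] is a quotient of [C]. By Gaschuetz's lemma every
   [e]-generated extension can be marked. That the kernel is [V]-homogeneous is
   used in the form: equivariant homomorphisms to [V] separate its points, which
   passes to fiber products. *)
Require Import Defs.
From Stdlib Require Import Classical_Prop.
From HB Require Import structures.
From mathcomp Require Import all_boot all_order all_algebra.
From mathcomp Require Import all_fingroup all_solvable all_field all_character.

Set Implicit Arguments.
Unset Strict Implicit.
Unset Printing Implicit Defensive.

Import GRing.Theory.
Local Open Scope group_scope.

Lemma multiplicative1 (G K : groupType) (f : {multiplicative G -> K}) : f 1 = 1.
Proof. by apply: (mulgI (f 1)); rewrite -gmulfM !mulg1. Qed.

Lemma multiplicativeV (G K : groupType) (f : {multiplicative G -> K}) :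
  {morph f : x / x^-1}.
Proof.
by move=> x; apply: (mulgI (f x)); rewrite -gmulfM !mulgV multiplicative1.
Qed.

(** * Homogeneous kernels and equivariant homomorphisms to [V] *)

Section Separation.

Variables (p : nat) (H : finGroupType).

(** Only the values of [phi] on the kernel of [f] are constrained; a total [phi] can be pulled back
    by plain composition. *)
Definition ker_hom (E : groupType) (f : E -> H) (n : nat)
    (rA : mx_representation 'F_p [set: H] n) (phi : E -> 'rV['F_p]_n) : Prop :=
  (forall x y, f x = 1 -> f y = 1 -> phi (x * y) = (phi x + phi y)%R) /\
  (forall x y, f x = 1 -> phi (x ^ y) = (phi x *m rA (f y))%R).

Definition separated (E : groupType) (f : E -> H) (n : nat)
    (rV : mx_representation 'F_p [set: H] n) : Prop :=
  forall x, f x = 1 -> (forall phi, ker_hom f rV phi -> phi x = 0%R) -> x = 1.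

Lemma ker_hom1 (E : groupType) (f : {multiplicative E -> H}) n
    (rA : mx_representation 'F_p [set: H] n) phi :
  ker_hom f rA phi -> phi 1 = 0%R.
Proof.
case=> phiM _; apply: (@addrI _ (phi 1)).
by rewrite addr0 -phiM ?multiplicative1 // mulg1.
Qed.

Lemma ker_homV (E : groupType) (f : {multiplicative E -> H}) n
    (rA : mx_representation 'F_p [set: H] n) phi x :
  ker_hom f rA phi -> f x = 1 -> phi x^-1 = (- phi x)%R.
Proof.
move=> hphi fx; apply: (@addrI _ (phi x)); rewrite addrN -(hphi.1) //.
  by rewrite mulgV (ker_hom1 hphi).
by rewrite multiplicativeV fx invg1.
Qed.

Lemma separated_eq (E : groupType) (f : {multiplicative E -> H}) n
    (rV : mx_representation 'F_p [set: H] n) x y :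
    separated f rV -> f x = 1 -> f y = 1 ->
  (forall phi, ker_hom f rV phi -> phi x = phi y) -> x = y.
Proof.
move=> sep fx fy eq_phi; apply/divg1_eq.
have fV: f y^-1 = 1 by rewrite multiplicativeV fy invg1.
apply: sep => [|phi hphi]; first by rewrite gmulfM fx fV mulg1.
by rewrite hphi.1 // (ker_homV hphi) // (eq_phi phi) // addrN.
Qed.

(** Every scalar of ['F_p] is a natural multiple of 1, so additive closure already makes [S] a
    submodule, and a nonzero submodule of a simple module is everything. *)
Lemma irr_additive_full n (rV : mx_representation 'F_p [set: H] n)
    (S : {pred 'rV['F_p]_n}) :
    mx_irreducible rV -> (0%R \in S) -> {in S &, forall u v, (u + v)%R \in S} ->
    {in S, forall u h, (u *m rV h)%R \in S} ->
    (exists2 v, v \in S & v != 0%R) ->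
  forall u, u \in S.
Proof.
move=> /mx_irrP[_ irrV] S0 SD SJ [v Sv nz_v] u.
(* The rows of [M] are the elements of [S], so its row space is [S] itself. *)
pose M := (\matrix_(i < #|S|) enum_val i)%R.
have subS w: (w <= M)%MS -> w \in S.
  case/submxP=> a ->; rewrite mulmx_sum_row; elim/big_rec: _ => // i w' _ Sw'.
  apply: (SD) => //; rewrite rowK -[a _ _]natr_Zp scaler_nat.
  elim: (nat_of_ord _) => [|k IHk]; first by rewrite mulr0n.
  by rewrite mulrS SD // enum_valP.
have subM w: w \in S -> (w <= M)%MS.
  by move=> Sw; rewrite (eq_row_sub (enum_rank_in Sw w)) // rowK enum_rankK_in.
have /irrV fullM: mxmodule rV <<M>>%MS.
  apply/mxmoduleP=> h _; rewrite (eqmxMr _ (genmxE M)) genmxE.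
  apply/row_subP=> i; rewrite row_mul; apply/subM/SJ/subS/row_sub.
apply: subS; rewrite -(genmxE M) submx_full // fullM //.
apply: contraNneq nz_v => M0; rewrite -submx0 -M0 genmxE; exact: subM.
Qed.

Lemma muln_grepr0 (rW : representation 'F_p [set: H]) :
  muln_grepr rW 0 = grepr0.
Proof. exact: big_ord0. Qed.

Lemma muln_greprS (rW : representation 'F_p [set: H]) k :
  muln_grepr rW k.+1 = dadd_grepr rW (muln_grepr rW k).
Proof. exact: big_ord_recl. Qed.

(* Adjoin separating homomorphisms one at a time: a homomorphism that does not
   vanish on the kernel of [Phi] maps that kernel onto the simple module [V], so
   the enlarged [Phi] stays surjective. *)
Lemma separated_coordinates (E : finGroupType) (f : {multiplicative E -> H}) n
    (rV : mx_representation 'F_p [set: H] n) :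
    epimorphism f -> mx_irreducible rV -> separated f rV ->
  exists k, exists2 Phi, ker_hom f (muln_grepr (Representation rV) k) Phi &
    (forall u, exists2 x, f x = 1 & Phi x = u) /\
    (forall x, f x = 1 -> Phi x = 0%R -> x = 1).
Proof.
move=> f_epi irrV sep; pose rW := Representation rV.
suffices [k [Phi hPhi [surj]]]: exists k, exists2 Phi,
    ker_hom f (muln_grepr rW k) Phi &
    (forall u, exists2 x, f x = 1 & Phi x = u) /\
    (#|[set x | f x == 1%g & Phi x == 0%R]| <= 1)%N.
  move=> ker1; exists k, Phi => //; split=> // x fx Phix.
  by apply: (card_le1_eqP ker1);
    rewrite inE ?fx ?Phix ?multiplicative1 ?(ker_hom1 hPhi) !eqxx.
(* [N.+1] bounds the number of kernel elements killed by [Phi], the identity included; each added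
   copy of [V] lowers this number. *)
suffices ind N k Phi : ker_hom f (muln_grepr rW k) Phi ->
    (forall u, exists2 x, f x = 1 & Phi x = u) ->
    (#|[set x | f x == 1%g & Phi x == 0%R]| <= N.+1)%N ->
  exists k, exists2 Phi, ker_hom f (muln_grepr rW k) Phi &
    (forall u, exists2 x, f x = 1 & Phi x = u) /\
    (#|[set x | f x == 1%g & Phi x == 0%R]| <= 1)%N.
(* The induction starts with no copies of [V]: the target has dimension 0 and all its vectors
   coincide. *)
- pose T := rdegree (muln_grepr rW 0).
  have T0: T = 0%N by rewrite /T muln_grepr0.
  have flat: forall u v : 'rV['F_p]_T, u = v.
    by rewrite T0 => u v; rewrite (thinmx0 u) (thinmx0 v).
  apply: (ind #|E| 0 (fun=> 0%R)); last first.
  - exact: leq_trans (max_card _) (leqnSn _).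
  - by move=> u; exists 1; [exact: multiplicative1 | exact: flat].
  by split=> *; apply: flat.
elim: N k Phi => [|N IHN] k Phi hPhi surj; first by exists k, Phi.
have [/(IHN k Phi hPhi surj) // | ltN leN] :=
  leqP #|[set x | f x == 1%g & Phi x == 0%R]| N.+1.
have [a [fa Pa nt_a]]: exists a, [/\ f a = 1, Phi a = 0%R & a != 1].
  have: (0 < #|[set x | f x == 1%g & Phi x == 0%R] :\ 1%g|)%N.
    have: (1 < #|[set x | f x == 1%g & Phi x == 0%R]|)%N by apply: leq_trans ltN.
    by rewrite (cardsD1 1%g); case: (1%g \in _) => // /ltnW.
  by case/card_gt0P=> a; rewrite !inE => /and3P[nt /eqP ? /eqP ?]; exists a.
have [phi hphi nz_phia]: exists2 phi, ker_hom f rV phi & phi a != 0%R.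
  apply: NNPP => no_phi; case/eqP: nt_a; apply: sep => // phi hphi.
  by apply/eqP/negPn/negP=> nz_phia; apply: no_phi; exists phi.
(* The image under [phi] of the kernel elements killed by [Phi]: a submodule of [V], nonzero because
   of [a]. *)
pose S := [pred v | [exists x, [&& f x == 1, Phi x == 0%R & phi x == v]]].
have S_full v : exists x, [/\ f x = 1, Phi x = 0%R & phi x = v].
  suffices /existsP[x /and3P[/eqP ? /eqP ? /eqP ?]] : v \in S by exists x.
  apply: (irr_additive_full irrV).
  - apply/existsP; exists 1; rewrite multiplicative1 (ker_hom1 hPhi) (ker_hom1 hphi).
    by rewrite !eqxx.
  - move=> u w /existsP[x /and3P[/eqP fx /eqP Px /eqP <-]].
    case/existsP=> y /and3P[/eqP fy /eqP Py /eqP <-]; apply/existsP; exists (x * y).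
    by rewrite gmulfM hPhi.1 // hphi.1 // fx fy Px Py mulg1 addr0 !eqxx.
  - move=> u /existsP[x /and3P[/eqP fx /eqP Px /eqP <-]] h.
    have [y fy]: exists y, f y = h by exact: f_epi.
    apply/existsP; exists (x ^ y); rewrite hPhi.2 // hphi.2 // Px mul0mx fy !eqxx.
    by rewrite !gmulfM multiplicativeV fx mul1g mulVg eqxx.
  - exists (phi a) => //; apply/existsP; exists a.
    by rewrite fa Pa !eqxx.
pose Phi' x : 'rV['F_p]_(rdegree (dadd_grepr rW (muln_grepr rW k))) :=
  row_mx (phi x) (Phi x).
move: (IHN k.+1); rewrite muln_greprS => {}IHN; apply: (IHN Phi').
- split=> [x y fx fy | x y fx].
    by rewrite /Phi' hphi.1 // hPhi.1 // add_row_mx.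
  by rewrite /Phi' hphi.2 // hPhi.2 // /= mul_row_block !mulmx0 add0r addr0.
(* [x] has the prescribed old coordinates; [y], which [Phi] kills, corrects the new one. *)
- move=> u; have [x fx Px] := surj (rsubmx u).
  have [y [fy Py phiy]] := S_full (lsubmx u - phi x)%R.
  exists (y * x); first by rewrite gmulfM fx fy mulg1.
  by rewrite /Phi' hphi.1 // hPhi.1 // Px Py phiy subrK add0r hsubmxK.
have Phi'0 x : Phi' x = 0%R -> phi x = 0%R /\ Phi x = 0%R.
  move=> Px0; split.
    by have := congr1 lsubmx Px0; rewrite row_mxKl linear0.
  by have := congr1 rsubmx Px0; rewrite row_mxKr linear0.
rewrite -ltnS; apply: leq_trans leN; apply: proper_card; apply/properP; split.
  apply/subsetP=> x; rewrite !inE => /andP[-> /eqP/Phi'0[_ ->]] /=.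
  by rewrite eqxx.
exists a; rewrite !inE fa ?Pa !eqxx //=; apply: contraNneq nz_phia.
by case/Phi'0 => -> _.
Qed.

(** The coordinate map [Phi] is bijective on the kernel, and its inverse serves as [iota]. *)
Lemma separated_extension (E : finGroupType) (f : {multiplicative E -> H}) n
    (rV : mx_representation 'F_p [set: H] n) :
    epimorphism f -> mx_irreducible rV -> separated f rV ->
  is_homogeneous_extension rV E.
Proof.
move=> f_epi irrV sep.
have [k [Phi hPhi [surj Phi_ker]]] := separated_coordinates f_epi irrV sep.
have Phi_inj x y : f x = 1 -> f y = 1 -> Phi x = Phi y -> x = y.
  move=> fx fy eq_xy; have fV: f y^-1 = 1 by rewrite multiplicativeV fy invg1.
  apply/divg1_eq/Phi_ker; first by rewrite gmulfM fx fV mulg1.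
  by rewrite hPhi.1 // (ker_homV hPhi) // eq_xy addrN.
have /fin_all_exists[iota iotaP]: forall u, exists x, f x = 1 /\ Phi x = u.
  by move=> u; have [x] := surj u; exists x.
have f_iota u : f (iota u) = 1 by case: (iotaP u).
have iotaK u : Phi (iota u) = u by case: (iotaP u).
exists (rdegree (muln_grepr (Representation rV) k)), (muln_grepr (Representation rV) k).
split; first by exists k; apply: mx_rsim_refl.
exists f => //; split=> [x y fx fy|].
  by apply: Phi_inj; rewrite ?gmulfM ?fx ?fy ?mulg1 // !hPhi.1 // addrC.
exists iota; split=> [|x|u v|u x].
- exact: can_inj iotaK.
- split=> [fx | [u <-] //]; exists (Phi x).
  by apply: Phi_inj; rewrite ?iotaK ?f_iota.
- by apply: Phi_inj; rewrite ?gmulfM ?f_iota ?mulg1 // hPhi.1 // !iotaK.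
apply: Phi_inj; rewrite ?f_iota ?hPhi.2 ?iotaK //.
by rewrite !gmulfM multiplicativeV f_iota mul1g mulVg.
Qed.

(** The projections onto the [k] summands are among the intertwining matrices [M]: [col_mx 1%:M 0]
    is the first one, and [col_mx 0 M] extends one from the remaining summands. *)
Lemma muln_grepr_coordinates (rW : representation 'F_p [set: H]) k
    (u : 'rV_(rdegree (muln_grepr rW k))) :
  (forall M, (forall h, muln_grepr rW k h *m M = M *m rW h)%R -> (u *m M = 0)%R) ->
  u = 0%R.
Proof.
elim: k u => [|k IHk].
  by rewrite muln_grepr0 => u _; rewrite (thinmx0 u).
rewrite muln_greprS /= => u uM; rewrite -[u]hsubmxK.
have -> : lsubmx u = 0%R.
  rewrite -[lsubmx u]addr0 -[RHS](uM (col_mx 1%:M 0)%R) => [|h].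
    by rewrite -[u in RHS]hsubmxK mul_row_col mulmx1 mulmx0.
  by rewrite mul_block_col mul_col_mx !mulmx1 !mulmx0 !mul0mx mul1mx !addr0.
rewrite [rsubmx u]IHk ?row_mx0 // => M homM.
rewrite -(uM (col_mx 0 M)%R) => [|h].
  by rewrite -[u in RHS]hsubmxK mul_row_col mulmx0 add0r.
by rewrite mul_block_col mul_col_mx homM !mulmx0 !mul0mx !add0r.
Qed.

Lemma homogeneous_coordinates n (rV : mx_representation 'F_p [set: H] n) m
    (rA : mx_representation 'F_p [set: H] m) (u : 'rV_m) :
    homogeneous rV rA ->
    (forall M, (forall h, rA h *m M = M *m rV h)%R -> (u *m M = 0)%R) ->
  u = 0%R.
Proof.
case=> k [B _ freeB homB] uM.
apply: (row_free_inj freeB); rewrite mul0mx.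
apply: muln_grepr_coordinates => M homM.
rewrite -mulmxA uM // => h.
by rewrite mulmxA homB ?inE // -!mulmxA homM.
Qed.

(** The inverse of [iota] followed by intertwining matrices gives the separating homomorphisms. [E]
    is finite since each element is a chosen lift from [H] times a kernel element; [T] and [r]
    record this. *)
Lemma extension_separated (E : groupType) n
    (rV : mx_representation 'F_p [set: H] n) :
    is_homogeneous_extension rV E ->
  exists2 f : {multiplicative E -> H}, epimorphism f /\ separated f rV &
  exists (T : finType) (r : T -> E), forall x, exists t, r t = x.
Proof.
case=> m [rA [homA [f f_epi [_ [iota [iota_inj iota_ker iotaD iotaJ]]]]]].
have f_iota u : f (iota u) = 1 by apply/iota_ker; exists u.
exists f; first split=> // x /iota_ker[u <-] sep_u.
  suffices ->: u = 0%R by apply: (mulgI (iota 0%R)); rewrite -iotaD addr0 mulg1.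
  apply: (homogeneous_coordinates homA) => M homM.
  (* A left inverse of [iota], with default value 0 off the kernel. *)
  pose j x := odflt 0%R [pick u | iota u == x].
  have iotaK v : j (iota v) = v.
    by rewrite /j; case: pickP => [w /eqP/iota_inj | /(_ v)/eqP].
  rewrite -[u]iotaK; apply: (sep_u (fun y => j y *m M)%R).
  split=> [_ _ /iota_ker[v <-] /iota_ker[w <-] | _ y /iota_ker[v <-]].
    by rewrite -iotaD !iotaK mulmxDl.
  by rewrite -iotaJ !iotaK -!mulmxA homM.
have /fin_all_exists[t tP]: forall h, exists x, f x = h by exact: f_epi.
exists (H * 'rV['F_p]_m)%type, (fun hu => t hu.1 * iota hu.2) => x.
have /iota_ker[u iotau]: f ((t (f x))^-1 * x) = 1.
  by rewrite gmulfM multiplicativeV tP mulVg.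
by exists (f x, u); rewrite /= iotau mulKVg.
Qed.

End Separation.

(** * Finite copies of groups and generating tuples *)

Lemma finite_groupType (E : groupType) (T : finType) (r : T -> E) :
    (forall x, exists t, r t = x) ->
  exists (G : finGroupType) (g : {multiplicative G -> E}), bijective g.
Proof.
(* A preimage under [r] encodes each element, which makes the carrier of [E] itself a finite type;
   [g] is then the identity map. *)
move=> r_surj; pose j x := [pick t | r t == x].
have jK : pcancel j (omap r).
  by move=> x; rewrite /j; case: pickP => [t /eqP <- // | no_t];
    have [t rt] := r_surj x; have := no_t t; rewrite rt eqxx.
pose Ecount : Countable.type := HB.pack (Group.sort E) (PCanIsCountable jK).
pose Efin : finType := HB.pack (Countable.sort Ecount) (@PCanIsFinite Ecount _ _ _ jK).
pose G : finGroupType := HB.pack (Group.sort E) E (Finite.class Efin).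
pose g : {multiplicative G -> E} :=
  HB.pack (fun x : G => x : E) (isMultiplicative.Build G E id (fun x y => erefl)).
by exists G, g; exists id.
Qed.

Definition generates (e : nat) (G : groupType) (x : 'I_e -> G) : Prop :=
  forall S : G -> Prop, is_subgroup S -> (forall i, S (x i)) -> forall g, S g.

Lemma generatesE e (G : finGroupType) (x : 'I_e -> G) :
  generates x <-> <<[set x i | i : 'I_e]>> = [set: G].
Proof.
split=> [x_gen | x_gen S [S1 SM SV] Sx g].
  apply/eqP; rewrite -subTset; apply/subsetP=> g _.
  apply: (x_gen (fun g => g \in <<[set x i | i : 'I_e]>>)) => [|i].
    by split=> *; rewrite ?group1 ?groupM ?groupV.
  by rewrite mem_gen ?imset_f.
have /gen_prodgP[m [c cX ->]]: g \in <<[set x i | i : 'I_e]>> by rewrite x_gen inE.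
by elim/big_ind: _ => // i _; have /imsetP[j _ ->] := cX i.
Qed.

Lemma generates_image e (G Q : groupType) (f : {multiplicative G -> Q})
    (x : 'I_e -> G) :
  epimorphism f -> generates x -> generates (f \o x).
Proof.
move=> f_epi x_gen S [S1 SM SV] Sx q; have [g <-] := f_epi q.
apply: (x_gen (fun g => S (f g))) => //; split.
- by rewrite multiplicative1.
- by move=> a b; rewrite gmulfM; apply: SM.
- by move=> a; rewrite multiplicativeV; apply: SV.
Qed.

(** The image of [f] is a subgroup containing a generating tuple. *)
Lemma generates_epi e (G Q : groupType) (f : {multiplicative G -> Q})
    (x : 'I_e -> G) :
  generates (f \o x) -> epimorphism f.
Proof.
move=> fx_gen; apply: fx_gen => [|i]; last by exists (x i).
split=> [|_ _ [a <-] [b <-]|_ [a <-]].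
- by exists 1; rewrite multiplicative1.
- by exists (a * b); rewrite gmulfM.
- by exists a^-1; rewrite multiplicativeV.
Qed.

(** * Gaschuetz's lemma, by counting lifts *)

Section Gaschutz.

Variables (E H : finGroupType) (f : {multiplicative E -> H}) (e : nat).
Implicit Types (g : 'I_e -> H) (y : {ffun 'I_e -> E}) (W : {group E}).

Definition span y : {group E} := <<[set y i | i : 'I_e]>>%G.

Definition lifts g : {set {ffun 'I_e -> E}} :=
  [set y : {ffun 'I_e -> E} | [forall i, f (y i) == g i]].

Definition covers W : Prop := forall h, exists2 w, w \in W & f w = h.

Lemma span_sub y W : reflect (forall i, y i \in W) (span y \subset W).
Proof.
rewrite gen_subG; apply: (iffP subsetP) => [yW i | yW _ /imsetP[i _ ->] //].
by rewrite yW ?imset_f.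
Qed.

(** Multiplying a lift of [g] coordinatewise by fixed elements of [W] above [(g i)^-1 * g' i] gives
    a lift of [g']; this is injective and stays inside [W]. *)
Lemma leq_card_lifts_sub W g g' : covers W ->
  (#|[set y in lifts g | span y \subset W]| <=
    #|[set y in lifts g' | span y \subset W]|)%N.
Proof.
move=> covW.
have /fin_all_exists[c cP]: forall i, exists c, c \in W /\ f c = (g i)^-1 * g' i.
  by move=> i; have [c] := covW ((g i)^-1 * g' i); exists c.
pose shift (y : {ffun _ -> E}) : {ffun _ -> E} := [ffun i => y i * c i].
have shift_inj : injective shift.
  by move=> y z /ffunP eq_yz; apply/ffunP=> i; have := eq_yz i; rewrite !ffunE => /mulIg.
rewrite -(card_imset _ shift_inj); apply/subset_leq_card/subsetP=> _ /imsetP[y + ->].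
rewrite !inE => /andP[/forallP fy /span_sub yW]; apply/andP; split.
  apply/forallP=> i; have [_ fc] := cP i.
  by rewrite ffunE gmulfM fc (eqP (fy i)) mulKVg.
by apply/span_sub=> i; rewrite ffunE groupM //; have [] := cP i.
Qed.

Lemma card_lifts_partition W g :
  #|[set y in lifts g | span y \subset W]| =
  (\sum_(U : {group E} | U \subset W) #|[set y in lifts g | span y == U]|)%N.
Proof.
rewrite -sum1_card (partition_big span (fun U : {group E} => U \subset W)) /=.
  apply: eq_bigr => U sUW; rewrite -sum1_card; apply: eq_bigl => y.
  rewrite !inE -andbA; congr andb.
  by apply: andb_idl => /eqP defU; rewrite -[<<_>>]/(gval (span y)) defU.
by move=> y; rewrite inE => /andP[].
Qed.

(* The number of generating lifts in W is independent of the generating tuple: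
   lifts lying in W are equinumerous, and those spanning a proper subgroup of W
   are counted by induction. *)
Lemma card_spanning_lifts W g g' : generates g -> generates g' ->
  #|[set y in lifts g | span y == W]| = #|[set y in lifts g' | span y == W]|.
Proof.
move=> g_gen g'_gen; have [N] := ubnP #|W|; elim: N W => // N IHN W /ltnSE leWN.
have [covW | not_covW] := classic (covers W).
  have eq_sub: #|[set y in lifts g | span y \subset W]| =
               #|[set y in lifts g' | span y \subset W]|.
    by apply/eqP; rewrite eqn_leq !leq_card_lifts_sub.
  move: eq_sub; rewrite !card_lifts_partition (bigD1 W) //= [in RHS](bigD1 W) //=.
  rewrite [X in (_ + X)%N = _](_ : _ =
    (\sum_(U : {group E} | (U \subset W) && (U != W))
      #|[set y in lifts g' | span y == U]|)%N); first by move/addIn.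
  apply: eq_bigr => U /andP[sUW neqUW]; apply: IHN.
  apply: leq_trans leWN; apply: proper_card.
  by rewrite properEneq sUW andbT.
(* If [W] does not map onto [H], no lift of a generating tuple can span it, and both counts are
   0. *)
suffices empty k : generates k -> [set y in lifts k | span y == W] = set0.
  by rewrite !empty.
move=> k_gen; apply/setP=> y; rewrite !inE; apply/negP=> /andP[/forallP fy /eqP spy].
case: not_covW; apply: k_gen => [|i]; last first.
  by exists (y i); [rewrite -spy mem_gen ?imset_f | exact/eqP].
split=> [|_ _ [a Wa <-] [b Wb <-]|_ [a Wa <-]].
- by exists 1; rewrite ?group1 ?multiplicative1.
- by exists (a * b); rewrite ?groupM ?gmulfM.
- by exists a^-1; rewrite ?groupV ?multiplicativeV.
Qed.

(** The image of a generating tuple of [E] has a generating lift; the number of such lifts is the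
    same for [h], hence positive. *)
Lemma gaschutz h :
    epimorphism f -> e_generated e E -> generates h ->
  exists2 y : 'I_e -> E, generates y & forall i, f (y i) = h i.
Proof.
move=> f_epi [x x_gen] h_gen.
have: (0 < #|[set y in lifts (f \o x) | span y == [set: E]%G]|)%N.
  apply/card_gt0P; exists (finfun x); rewrite !inE; apply/andP; split.
    by apply/forallP=> i; rewrite ffunE.
  apply/eqP/group_inj; rewrite /= -(proj1 (generatesE x) x_gen).
  by congr <<_>>; apply: eq_imset => i; rewrite ffunE.
rewrite (card_spanning_lifts _ (generates_image f_epi x_gen) h_gen).
case/card_gt0P=> y; rewrite !inE => /andP[/forallP fy /eqP spy].
by exists y => [|i]; [apply/generatesE; rewrite -[RHS]/(gval [set: E]%G) -spy | apply/eqP].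
Qed.

End Gaschutz.

(** * Schreier's bound on the order of an extension *)

Section Bound.

Variables (p : nat) (p_prime : prime p) (H : finGroupType) (n : nat).
Variable rV : mx_representation 'F_p [set: H] n.

(** Homomorphisms to [V] do not distinguish [a * b] from [b * a] and kill [p]-th powers, so
    separation forces both relations in the kernel. *)
Lemma separated_abelem (E : finGroupType) (f : {multiplicative E -> H})
    (A : {group E}) :
  separated f rV -> {in A, forall a, f a = 1} -> p.-abelem A.
Proof.
move=> sep fA; rewrite abelemE //; apply/andP; split.
  apply/centsP=> a Aa b Ab; apply: (separated_eq sep).
  - by rewrite gmulfM !fA ?mulg1.
  - by rewrite gmulfM !fA ?mulg1.
  by move=> phi hphi; rewrite !hphi.1 ?fA // addrC.
apply/exponentP=> a Aa; apply: sep => [|phi hphi]; first by rewrite fA ?groupX.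
have phiX k : phi (a ^+ k) = (phi a *+ k)%R.
  elim: k => [|k IHk]; first by rewrite expg0 mulr0n (ker_hom1 hphi).
  by rewrite expgS hphi.1 ?fA ?groupX // IHk mulrS.
by rewrite phiX -scaler_nat pchar_Fp_0 // scale0r.
Qed.

(* Schreier: a section [t] of [f] yields the [e * #|H|] kernel elements
   [t k * x i * (t (k * f (x i)))^-1], and the subgroup [A] they generate
   satisfies [E = A * t(H)]. *)
Lemma leq_card_separated e (E : finGroupType) (f : {multiplicative E -> H})
    (x : 'I_e -> E) :
    epimorphism f -> generates x -> separated f rV ->
  (#|E| <= p ^ (e * #|H|) * #|H|)%N.
Proof.
move=> f_epi x_gen sep.
have /fin_all_exists[t ft]: forall h, exists y, f y = h by exact: f_epi.
pose s (ik : 'I_e * H) := t ik.2 * x ik.1 * (t (ik.2 * f (x ik.1)))^-1.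
pose A : {group E} := <<[set s ik | ik : 'I_e * H]>>%G.
have As i k : s (i, k) \in A by rewrite mem_gen ?imset_f.
have kerG : group_set [set y | f y == 1].
  apply/group_setP; split=> [|y z]; rewrite !inE ?multiplicative1 //.
  by move=> /eqP fy /eqP fz; rewrite gmulfM fy fz mulg1.
have fA : {in A, forall a, f a = 1}.
  have /subsetP sAK: A \subset group kerG.
    rewrite gen_subG; apply/subsetP=> _ /imsetP[[i k] _ ->].
    by rewrite inE /s /= !gmulfM multiplicativeV !ft mulgV.
  by move=> a /sAK; rewrite inE => /eqP.
pose L y := exists2 a, a \in A & exists k, y = a * t k.
have L_all y : L y.
  (* [L] is not yet known to be a group, so stability under right multiplication is carried for [z]
     and [z^-1] together. *)
  pose S z := forall y, L y -> L (y * z) /\ L (y * z^-1).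
  have S_all: forall z, S z.
    apply: x_gen => [|i].
      split=> [w|a b Sa Sb w Lw|a Sa w /Sa[]].
      - by rewrite invg1 mulg1.
      - split; first by rewrite mulgA; apply Sb, Sa.
        by rewrite invMg mulgA; apply Sa, Sb.
      by rewrite invgK.
    move=> _ [a Aa [k ->]]; split.
      exists (a * s (i, k)); first by rewrite groupM.
      by exists (k * f (x i)); rewrite /s /= !mulgA mulgKV.
    exists (a * (s (i, k * (f (x i))^-1))^-1); first by rewrite groupM ?groupV.
    exists (k * (f (x i))^-1).
    by rewrite /s /= !invMg invgK mulgKV !mulgA mulgKV.
  (* The orbit starts at [t 1], which need not be 1. *)
  have L1: L (t 1) by exists 1 => //; exists 1; rewrite mul1g.
  by rewrite -(mulKVg (t 1) y); apply S_all.
have abelA := separated_abelem sep fA.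
(* An elementary abelian group has order [p] to its rank, and the rank is at most the number of
   generators. *)
have leA : (#|A| <= p ^ (e * #|H|))%N.
  rewrite (card_pgroup (abelem_pgroup abelA)) -rank_abelem //.
  rewrite -grank_abelian ?(abelem_abelian abelA) // leq_exp2l ?prime_gt1 //.
  apply: leq_trans (grank_min _) _; apply: leq_trans (leq_imset_card _ _) _.
  by rewrite card_prod card_ord.
apply: leq_trans (leq_mul leA (leqnn _)); rewrite -cardsT -[#|H|]cardsT -cardsX.
apply: leq_trans (leq_imset_card (fun ak => ak.1 * t ak.2) _).
apply/subset_leq_card/subsetP=> y _; have [a Aa [k ->]] := L_all y.
by apply/imsetP; exists (a, k); rewrite // !inE Aa.
Qed.

End Bound.

(** * Fiber products of marked extensions *)

Lemma ker_hom_comp p (H : finGroupType) (E G : groupType) (f : E -> H)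
    (q : {multiplicative G -> E}) n (rA : mx_representation 'F_p [set: H] n)
    (phi : E -> 'rV_n) :
  ker_hom f rA phi -> ker_hom (f \o q) rA (phi \o q).
Proof.
case=> phiM phiJ; split=> [x y fx fy | x y fx] /=; first by rewrite gmulfM phiM.
by rewrite !gmulfM multiplicativeV -phiJ.
Qed.

Lemma is_subgroup_eq (G K : groupType) (f g : {multiplicative G -> K}) :
  is_subgroup (fun x => f x = g x).
Proof.
split=> [|x y fgx fgy|x fgx]; first by rewrite !multiplicative1.
  by rewrite !gmulfM fgx fgy.
by rewrite !multiplicativeV fgx.
Qed.

Definition comp_mult (G K L : groupType) (g : {multiplicative K -> L})
    (f : {multiplicative G -> K}) : {multiplicative G -> L} :=
  g \o f.

Section FiberProduct.

Variables (p : nat) (H : finGroupType) (n e : nat).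
Variables (rV : mx_representation 'F_p [set: H] n) (h : 'I_e -> H).

Definition marked_extension (E : groupType) (f : {multiplicative E -> H})
    (x : 'I_e -> E) : Prop :=
  [/\ generates x, forall i, f (x i) = h i & separated f rV].

(** Homomorphisms to [V] pulled back along the two projections force both coordinates of an
    unseparated kernel element to be 1. *)
Lemma marked_fiber_product (C E : finGroupType) (fC : {multiplicative C -> H})
    (fE : {multiplicative E -> H}) (xC : 'I_e -> C) (xE : 'I_e -> E) :
    marked_extension fC xC -> marked_extension fE xE ->
  exists (D : finGroupType) (fD : {multiplicative D -> H}) (xD : 'I_e -> D),
    marked_extension fD xD /\
    (exists qC : {multiplicative D -> C}, epimorphism qC) /\
    (exists qE : {multiplicative D -> E}, epimorphism qE).
Proof.
move=> [xC_gen fxC sepC] [xE_gen fxE sepE].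
pose X := [set (xC i, xE i) | i : 'I_e]; pose D : finGroupType := subg_of <<X>>.
pose qC : {multiplicative D -> C} := HB.pack (fun d : D => (sgval d).1)
  (isMultiplicative.Build D C (fun d : D => (sgval d).1) (fun x y => erefl)).
pose qE : {multiplicative D -> E} := HB.pack (fun d : D => (sgval d).2)
  (isMultiplicative.Build D E (fun d : D => (sgval d).2) (fun x y => erefl)).
pose xD i : D := subg <<X>> (xC i, xE i).
have xDE i : sgval (xD i) = (xC i, xE i) by rewrite subgK // mem_gen ?imset_f.
have xD_gen : generates xD.
  move=> S [S1 SM SV] Sx d.
  have /gen_prodgP[m [c cX dE]] := subgP d.
  suffices [d' eq_d Sd'] : exists2 d', sgval d' = sgval d & S d'.
    by rewrite -(subg_inj eq_d).
  rewrite dE; elim/big_ind: _ => [|_ _ [a <- Sa] [b <- Sb]|i _].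
  - by exists 1.
  - by exists (a * b) => //; apply: SM.
  by have /imsetP[j _ ->] := cX i; exists (xD j).
(* The two maps to [H] agree on the generators [xD], hence on all of [D], which therefore lies in
   the fiber product over [H]. *)
have fqCE d : comp_mult fC qC d = comp_mult fE qE d.
  apply: (xD_gen _ (is_subgroup_eq (comp_mult fC qC) (comp_mult fE qE))) => i.
  by rewrite /= xDE /= fxC fxE.
exists D, (comp_mult fC qC), xD; split; first split=> //.
- by move=> i; rewrite /= xDE fxC.
- move=> d fd sep_d; apply: subg_inj.
  have d1: qC d = 1.
    by apply: sepC => // phi hphi; apply: (sep_d (phi \o qC)); apply: ker_hom_comp.
  have d2: qE d = 1.
    apply: sepE => [|phi hphi]; first by rewrite fqCE in fd.
    apply: (sep_d (phi \o qE)); have [phiM phiJ] := ker_hom_comp qE hphi.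
    split=> [x y | x y]; rewrite !fqCE; first exact: phiM.
    exact: phiJ.
  by rewrite [LHS]surjective_pairing; congr pair.
have epi (K : groupType) (q : {multiplicative D -> K}) x :
    generates x -> (forall i, q (xD i) = x i) -> epimorphism q.
  move=> x_gen qx; apply: (@generates_epi e _ _ q xD) => S gS Sx.
  by apply: x_gen => // i; rewrite -qx; apply: Sx.
split; [exists qC | exists qE].
  by apply: (epi _ _ xC) => // i; rewrite /= xDE.
by apply: (epi _ _ xE) => // i; rewrite /= xDE.
Qed.

End FiberProduct.

(** * Maximal marked extensions and the cover *)

(** [P] need not be decidable, so excluded middle decides whether a larger value exists; the
    distance [B - m] then drops. *)
Lemma ex_max_nat (P : nat -> Prop) B m :
    P m -> (forall k, P k -> k <= B)%N ->
  exists2 N, P N & (forall k, P k -> k <= N)%N.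
Proof.
move=> Pm leB; have [d] := ubnP (B - m)%N; elim: d m Pm => // d IHd m Pm /ltnSE led.
have [[k Pk lt_mk] | no_k] := classic (exists2 k, P k & (m < k)%N).
  apply: (IHd k Pk); apply: leq_trans led.
  by rewrite ltn_sub2l // (leq_trans lt_mk) // leB.
exists m => // k Pk; rewrite leqNgt; apply/negP=> lt_mk.
by apply: no_k; exists k.
Qed.

Theorem theorem1p2 (e p : nat) (e_gt0 : (0 < e)%N) (p_prime : prime p)
    (H : finGroupType) (H_gen : e_generated e H)
    (n : nat) (rV : mx_representation 'F_p [set: H] n)
    (V_simple : mx_irreducible rV) :
  exists C : finGroupType,
    [/\ e_generated e C,
        is_homogeneous_extension rV C
      & forall E : groupType,
          e_generated e E -> is_homogeneous_extension rV E ->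
          is_quotient_of E C].
Proof.
have [h h_gen] := H_gen.
have epi (E : groupType) (f : {multiplicative E -> H}) x :
    (forall i, f (x i) = h i) -> epimorphism f.
  move=> fx; apply: (@generates_epi e _ _ f x) => S gS Sx.
  by apply: h_gen => // i; rewrite -fx; apply: Sx.
pose P N := exists (E : finGroupType) (f : {multiplicative E -> H}) x,
  #|E| = N /\ marked_extension rV h f x.
(* [H] over itself is a marked extension with trivial kernel, so the maximum is taken over a
   nonempty set. *)
have PH : P #|H|.
  pose idH : {multiplicative H -> H} :=
    HB.pack (@id H) (isMultiplicative.Build H H id (fun x y => erefl)).
  by exists H, idH, h; do 2!split.
have leP N : P N -> (N <= p ^ (e * #|H|) * #|H|)%N.
  case=> E [f [x [<- [x_gen fx sep]]]].
  by apply: (leq_card_separated p_prime _ x_gen sep); apply: epi fx.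
have [_ [C [fC [xC [<- markC]]]] maxC] := ex_max_nat PH leP.
have [xC_gen fxC sepC] := markC; have fC_epi := epi _ _ _ fxC.
exists C; split; [by exists xC | exact: separated_extension fC_epi _ _ | ].
move=> E0 E0_gen /extension_separated[f0 [f0_epi sep0] [T [r r_surj]]].
(* [E0] is replaced by an isomorphic finite group [E], to which the counting arguments apply. *)
have [E [g [g' gK g'K]]] := finite_groupType r_surj.
pose g1 : {multiplicative E0 -> E} :=
  HB.pack g' (isMultiplicative.Build E0 E g' (can2_gmulfM gK g'K)).
have g1_epi : epimorphism g1 by move=> x; exists (g x); exact: gK.
pose f := comp_mult f0 g.
have f_epi : epimorphism f.
  by move=> k; have [x <-] := f0_epi k; exists (g' x); rewrite /= g'K.
have E_gen : e_generated e E.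
  by have [x x_gen] := E0_gen; exists (g1 \o x); apply: generates_image.
have sep : separated f rV.
  move=> x fx sep_x; apply: (can_inj gK); rewrite multiplicative1.
  apply: sep0 => // phi hphi; apply: (sep_x (phi \o g)).
  exact: (ker_hom_comp g hphi).
have [x x_gen fx] := gaschutz f_epi E_gen h_gen.
have markE : marked_extension rV h f x by split.
have [D [fD [xD [markD [[qC qC_epi] [qE qE_epi]]]]]] := marked_fiber_product markC markE.
have leDC : (#|D| <= #|C|)%N by apply: maxC; exists D, fD, xD.
(* A section [s] of [qC] is injective, hence bijective because [D] is no larger than [C]; so it is a
   two-sided inverse and a homomorphism. *)
have /fin_all_exists[s sK]: forall c, exists d, qC d = c by exact: qC_epi.
have [s' s'K sK'] := inj_card_bij (can_inj sK) leDC.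
have qC_s d : s (qC d) = d by rewrite -{1}[d]sK' sK sK'.
have sM : {morph s : a b / a * b} by move=> a b; rewrite -[RHS]qC_s gmulfM !sK.
pose s1 : {multiplicative C -> D} := HB.pack s (isMultiplicative.Build C D s sM).
(* The quotient map is the composite from [C] through [D] and [E] to [E0]. *)
exists (comp_mult g (comp_mult qE s1)) => y.
have [d qd] := qE_epi (g' y); exists (qC d).
by rewrite /= qC_s qd g'K.
Qed.
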